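(* Let $1\le p<2$. For every graph $G$ of order $n$, $$\|G\|_{S_p}^p\le 2^{-p}n^{1+p/2}+n^p.$$ This bound is tight in the following sense: for all $n$ there is a graph $G$ of order $n$ satisfying $$\|G\|_{S_p}^p=\left(2^{-p}+o(1)\right)n^{1+p/2},$$ where $o(1)\to0$ as $n\to\infty$ (with $p$ fixed).
   Context: Graphs are finite, simple and undirected; the order of a graph is its number of vertices. For a graph $G$ of order $n$ with adjacency matrix $A$, let $\sigma_1(G)\ge\cdots\ge\sigma_n(G)$ be the singular values of $A$ (the absolute values of its eigenvalues), and for real $p\ge1$ let $\|G\|_{S_p}=\left(\sigma_1^p(G)+\cdots+\sigma_n^p(G)\right)^{1/p}$ be the Schatten $p$-norm. *)

(* Defs.v *)
From HB Require Import structures.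
From mathcomp Require Import all_boot all_order all_algebra.
From mathcomp Require Import all_classical all_reals all_analysis.
From mathcomp Require Import polyrcf.

Set Implicit Arguments.
Unset Strict Implicit.
Unset Printing Implicit Defensive.

Import Order.TTheory GRing.Theory Num.Theory.
Import numFieldNormedType.Exports.

Local Open Scope classical_set_scope.
Local Open Scope ring_scope.

Record sgraph := SGraph {
  vertex : finType;
  edge : rel vertex;
  edge_sym : symmetric edge;
  edge_irrefl : irreflexive edge
}.

Definition gorder (G : sgraph) : nat := #|vertex G|.

Definition adjmx (R : realType) (G : sgraph) : 'M[R]_(gorder G) :=
  \matrix_(i, j) (edge (enum_val i) (enum_val j))%:R.

(* The real eigenvalues of [A], each repeated according to its multiplicity
   as a root of the characteristic polynomial. When [A] is symmetric these are
   all [n] eigenvalues. *)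
Definition eigenvalues (R : realType) (n : nat) (A : 'M[R]_n) : seq R :=
  flatten [seq nseq (mup x (char_poly A)) x | x <- rootsR (char_poly A)].

(* In nonincreasing order. Moduli of eigenvalues are the singular values
   because the adjacency matrix is symmetric. *)
Definition singular_values (R : realType) (G : sgraph) : seq R :=
  sort >=%R [seq `|x| | x <- eigenvalues (adjmx R G)].

(* 0-based: [sigma R G i] is the (i+1)-st largest singular value. *)
Definition sigma (R : realType) (G : sgraph) (i : nat) : R :=
  (singular_values R G)`_i.

Definition schatten_norm (R : realType) (p : R) (G : sgraph) : R :=
  (\sum_(i < gorder G) sigma R G i `^ p) `^ p^-1.

(* Main.v *)
Require Import Defs.
From HB Require Import structures.
From mathcomp Require Import all_boot all_order all_algebra.
From mathcomp Require Import all_classical all_reals all_analysis.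
From mathcomp Require Import polyrcf complex.
From mathcomp Require Import ring lra.
Set Implicit Arguments.
Unset Strict Implicit.
Unset Printing Implicit Defensive.
Import Order.TTheory GRing.Theory Num.Theory.
Import numFieldNormedType.Exports.
Local Open Scope classical_set_scope.
Local Open Scope ring_scope.

(* Upper bound: let s be the sum of the entries of A, which is also the sum of
   the squares of its eigenvalues. By the Rayleigh quotient of the all-ones
   vector, some eigenvalue has modulus at least s / n, so the squares of the
   others sum to at most s - (s / n)^2 <= n^2 / 4, and concavity of
   t |-> t^(p/2) bounds the sum of their p-th powers. The exceptional eigenvalue
   contributes at most n^p.

   Tightness: let H be a symmetric Hadamard matrix of order r^2 with unit
   diagonal and all row sums equal to r. Then A = (J - H) / 2 is an adjacency
   matrix with A^2 = (r^2 / 4) I + ((r^2 - 2 r) / 4) J, so all its eigenvalues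
   have modulus at least r / 2. After adding isolated vertices up to order n, an
   eigenvalue with a unit eigenvector of squared mass w on the r^2 original
   vertices has modulus at least (r / 2) sqrt w >= (r / 2) w^(1/p), and these
   masses sum to r^2. Such matrices are closed under Kronecker products and exist for r = 2 and
   r = 6, hence for all r = 2^a 6^b. As log 2 and log 6 are incommensurable, some
   such r satisfies r^2 <= n and r^2 = (1 - o(1)) n. *)

(** * Spectra of real symmetric matrices *)

Section SymmetricSpectrum.
Local Open Scope sesquilinear_scope.
Local Notation toC := (real_complex _).

(* The rows of X and Y are the real and imaginary parts of a unitary eigenbasis
   of A: real eigenvectors forming a Parseval frame, which replaces a real
   orthonormal eigenbasis. *)
Lemma symmetric_spectral_frame (R : rcfType) (n : nat) (A : 'M[R]_n) :
  A^T = A ->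
  exists (lam : 'rV[R]_n) (X Y : 'M[R]_n),
    [/\ char_poly A = \prod_i ('X - (lam 0 i)%:P),
        X *m A = diag_mx lam *m X /\ Y *m A = diag_mx lam *m Y,
        X^T *m X + Y^T *m Y = 1%:M
      & forall i, \sum_j (X i j ^+ 2 + Y i j ^+ 2) = 1].
Proof.
move=> symA; pose B := map_mx toC A.
have Bherm : B \is hermsymmx.
  apply: realsym_hermsym.
    apply/is_hermitianmxP; rewrite expr0 scale1r.
    by rewrite map_mx_id//; apply/matrixP => i j; rewrite !mxE -[in LHS]symA mxE.
  by apply/mxOverP => i j; rewrite mxE complex_real.
pose U := spectralmx B; pose d := spectral_diag B.
have Uunit : U \in unitmx by exact: spectral_unit.
have BE : B = invmx U *m diag_mx d *m U.
  by apply/orthomx_spectralP; exact: hermitian_normalmx.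
have UB : U *m B = diag_mx d *m U by rewrite {1}BE !mulmxA mulmxV// mul1mx.
have [lam dE] : exists lam, d = map_mx toC lam.
  exists (map_mx (@complex.Re R) d); apply/rowP => i; rewrite !mxE RRe_real//.
  by have /mxOverP := hermitian_spectral_diag_real Bherm; apply.
exists lam, (map_mx (@complex.Re R) U), (map_mx (@complex.Im R) U); split.
- apply: (@map_poly_inj _ _ toC).
  rewrite map_char_poly -/B.
  have -> : char_poly B = char_poly (diag_mx d).
    rewrite /char_poly /char_poly_mx BE.
    set P := map_mx polyC U; set Q := map_mx polyC (invmx U).
    have QP : Q *m P = 1%:M by rewrite -map_mxM mulVmx// map_mx1.
    rewrite !map_mxM -/P -/Q.
    have -> : 'X%:M - Q *m map_mx polyC (diag_mx d) *m P =
              Q *m ('X%:M - map_mx polyC (diag_mx d)) *m P.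
      by rewrite mulmxBr mulmxBl scalar_mxC -[X in _ = X - _]mulmxA QP mulmx1.
    by rewrite !det_mulmx mulrAC -det_mulmx QP det1 mul1r.
  rewrite char_poly_trig ?diag_mx_is_trig// rmorph_prod.
  apply: eq_bigr => i _; rewrite mxE eqxx mulr1n rmorphB /= map_polyX map_polyC.
  by rewrite dE mxE.
(* As [A] and [lam] are real, [U *m B = diag_mx d *m U] splits into real and imaginary parts. *)
- have Re_toC (z : R[i]) (a : R) : complex.Re (z * toC a) = complex.Re z * a.
    by case: z => x y /=; rewrite mulr0 subr0.
  have Im_toC (z : R[i]) (a : R) : complex.Im (z * toC a) = complex.Im z * a.
    by case: z => x y /=; rewrite mulr0 add0r.
  have UBE i k : \sum_j U i j * toC (A j k) = U i k * toC (lam 0 i).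
    have /matrixP/(_ i k) := UB; rewrite mul_diag_mx !mxE dE mxE mulrC => <-.
    by apply: eq_bigr => j _; rewrite mxE.
  split; apply/matrixP => i k; rewrite mul_diag_mx !mxE mulrC.
    rewrite -Re_toC -UBE raddf_sum.
    by apply: eq_bigr => j _; rewrite !mxE -Re_toC.
  rewrite -Im_toC -UBE raddf_sum.
  by apply: eq_bigr => j _; rewrite !mxE -Im_toC.
- have UU : U ^t* *m U = 1%:M by rewrite -invmx_unitary ?spectral_unitarymx// mulVmx.
  apply/matrixP => i k; have /matrixP/(_ i k) := UU; rewrite !mxE.
  move/(congr1 (@complex.Re R)); rewrite raddf_sum raddfMn /= => <-.
  rewrite -big_split; apply: eq_bigr => j _ /=; rewrite !mxE.
  by case: (U j i) => a b; case: (U j k) => a' b' /=; rewrite mulNr opprK.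
- move=> i; have /unitarymxP UU := spectral_unitarymx B.
  have /matrixP/(_ i i) := UU; rewrite !mxE eqxx.
  move/(congr1 (@complex.Re R)); rewrite raddf_sum /= => <-.
  apply: eq_bigr => j _ /=; rewrite !mxE.
  by rewrite -/U; case: (U i j) => a b /=; rewrite mulrN opprK.
Qed.

End SymmetricSpectrum.

(** Both lists contain each [x] as often as its multiplicity as a root. *)
Lemma perm_eigenvalues (R : realType) (n : nat) (A : 'M[R]_n) (s : seq R) :
  char_poly A = \prod_(x <- s) ('X - x%:P) -> perm_eq (eigenvalues A) s.
Proof.
move=> As; apply/allP => x _ /=; apply/eqP.
have p0 : char_poly A != 0 by rewrite monic_neq0// char_poly_monic.
have uroots : uniq (rootsR (char_poly A)) by exact: uniq_roots.
rewrite /eigenvalues count_flatten -!map_comp.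
rewrite (eq_map (g := fun y => if y == x then mup x (char_poly A) else 0%N)); last first.
  move=> y /=; rewrite count_nseq /=.
  by case: (y =P x) => [->|]; rewrite ?mul1n ?mul0n.
rewrite sumnE big_map -big_mkcond /= -[in RHS]mu_prod_XsubC -As.
have rP : (x \in rootsR (char_poly A)) = root (char_poly A) x.
  by rewrite -(roots_on_rootsR p0) inE.
have [xr|xr] := boolP (root (char_poly A) x); last first.
  by rewrite mupNroot// big1.
by rewrite big_const_seq iter_addn_0 count_uniq_mem// rP xr muln1.
Qed.

Lemma schatten_norm_powR (R : realType) (p : R) (G : sgraph)
    (lam : 'rV[R]_(gorder G)) : 0 < p ->
  char_poly (adjmx R G) = \prod_i ('X - (lam 0 i)%:P) ->
  schatten_norm p G `^ p = \sum_i `|lam 0 i| `^ p.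
Proof.
move=> p0 Glam; pose s := [seq lam 0 i | i <- enum 'I_(gorder G)].
have es : perm_eq (eigenvalues (adjmx R G)) s.
  by apply: perm_eigenvalues; rewrite Glam /s big_map big_enum.
have ss : perm_eq (singular_values R G) [seq `|x| | x <- s].
  by rewrite perm_sort perm_map.
rewrite /schatten_norm -powRrM mulVf ?gt_eqF// powRr1; last first.
  by apply: sumr_ge0 => i _; exact: powR_ge0.
(* With exactly [gorder G] entries, the default value of [nth] never enters the sum. *)
have sz : size (singular_values R G) = gorder G.
  by rewrite (perm_size ss) !size_map -enumT size_enum_ord.
rewrite -(big_mkord xpredT (fun i => sigma R G i `^ p)) -[in LHS]sz.
rewrite -(big_nth 0 xpredT (fun x => x `^ p)) (perm_big _ ss) /=.
by rewrite /s !big_map -enumT big_enum.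
Qed.

Section SpectralFrame.
Variables (R : realType) (n : nat) (A : 'M[R]_n) (symA : A^T = A).
Variables (lam : 'rV[R]_n) (X Y : 'M[R]_n).
Hypothesis XA : X *m A = diag_mx lam *m X.
Hypothesis YA : Y *m A = diag_mx lam *m Y.
Hypothesis XY1 : X^T *m X + Y^T *m Y = 1%:M.
Hypothesis XYn : forall i, \sum_j (X i j ^+ 2 + Y i j ^+ 2) = 1.

Lemma sqr_spectrum_row i :
  lam 0 i ^+ 2 = \sum_j ((X *m A) i j ^+ 2 + (Y *m A) i j ^+ 2).
Proof.
rewrite XA YA -[LHS]mulr1 -(XYn i) mulr_sumr.
by apply: eq_bigr => j _; rewrite !mul_diag_mx !mxE; ring.
Qed.

Lemma frame_colsum j k : \sum_i (X i j * X i k + Y i j * Y i k) = (j == k)%:R.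
Proof.
have /matrixP/(_ j k) := XY1; rewrite !mxE => <-.
by rewrite -big_split; apply: eq_bigr => i _; rewrite /= !mxE.
Qed.

(** The Parseval identity, inserted into the trace of [A^T *m A], turns it into a sum over
    eigenvectors. *)
Lemma sum_sqr_spectrum : \sum_i lam 0 i ^+ 2 = \sum_i \sum_j A i j ^+ 2.
Proof.
have -> : \sum_i \sum_j A i j ^+ 2 = \tr (A^T *m (X^T *m X + Y^T *m Y) *m A).
  rewrite XY1 mulmx1 exchange_big; apply: eq_bigr => j _.
  by rewrite mxE; apply: eq_bigr => i _; rewrite mxE expr2.
rewrite mulmxDr mulmxDl !mulmxA -!trmx_mul -!mulmxA raddfD /= /mxtrace.
rewrite (eq_bigr _ (fun i _ => sqr_spectrum_row i)).
rewrite exchange_big -big_split; apply: eq_bigr => j _ /=.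
rewrite big_split /= [in RHS]mxE [in RHS]mxE; congr +%R.
  by apply: eq_bigr => i _; rewrite [in RHS]mxE expr2.
by apply: eq_bigr => i _; rewrite [in RHS]mxE expr2.
Qed.

(** [w i] is the squared modulus of the pairing of the i-th eigenvector with the all-ones vector,
    whose Rayleigh quotient is thus a weighted mean of the eigenvalues. *)
Lemma rayleigh_weights :
  exists w : 'I_n -> R,
    [/\ forall i, 0 <= w i, \sum_i w i = n%:R
      & \sum_i lam 0 i * w i = \sum_i \sum_j A i j].
Proof.
pose w i := (\sum_j X i j) ^+ 2 + (\sum_j Y i j) ^+ 2; exists w.
have sumM (a b : 'I_n -> R) (c : 'I_n -> R) (d : 'I_n -> R) :
    (\sum_j a j) * (\sum_k b k) + (\sum_j c j) * (\sum_k d k) =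
    \sum_j \sum_k (a j * b k + c j * d k).
  rewrite !mulr_suml -big_split; apply: eq_bigr => j _ /=.
  by rewrite !mulr_sumr -big_split.
split=> [i||].
- by rewrite addr_ge0 ?sqr_ge0.
- transitivity (\sum_i \sum_j \sum_k (X i j * X i k + Y i j * Y i k)).
    by apply: eq_bigr => i _; rewrite /w !expr2 sumM.
  rewrite exchange_big (eq_bigr (fun=> 1)) ?sumr_const ?card_ord// => j _.
  rewrite exchange_big (bigD1 j)//= [X in _ + X]big1 => [|k kj].
    by rewrite frame_colsum eqxx addr0.
  by rewrite frame_colsum eq_sym (negbTE kj).
- transitivity (\sum_i \sum_j \sum_k (X i j * (X *m A) i k + Y i j * (Y *m A) i k)).
  have sumD (Z : 'M[R]_n) i : \sum_k (diag_mx lam *m Z) i k = lam 0 i * \sum_k Z i k.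
    by rewrite mulr_sumr; apply: eq_bigr => k _; rewrite mul_diag_mx mxE.
  by apply: eq_bigr => i _; rewrite -sumM /w XA YA !sumD; ring.
rewrite exchange_big; apply: eq_bigr => j _.
rewrite exchange_big; apply: eq_bigr => k _.
transitivity ((X^T *m (X *m A) + Y^T *m (Y *m A)) j k).
  move: (X *m A) (Y *m A) => P Q; rewrite !mxE -big_split.
  by apply: eq_bigr => i _; rewrite !mxE.
by rewrite !mulmxA -mulmxDl XY1 mul1mx.
Qed.

(** [w i] is the squared mass of the i-th unit eigenvector on [S]; the hypothesis is applied to its
    real and imaginary parts. *)
Lemma compression_weights (S : pred 'I_n) (a : R) :
  (forall u : 'rV[R]_n, a * \sum_(j | S j) u 0 j ^+ 2 <= \sum_j (u *m A) 0 j ^+ 2) ->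
  exists w : 'I_n -> R,
    [/\ forall i, 0 <= w i <= 1, \sum_i w i = #|S|%:R
      & forall i, a * w i <= lam 0 i ^+ 2].
Proof.
move=> aS; exists (fun i => \sum_(j | S j) (X i j ^+ 2 + Y i j ^+ 2)).
have pos i j : 0 <= X i j ^+ 2 + Y i j ^+ 2 by rewrite addr_ge0// sqr_ge0.
split=> [i||i].
- rewrite sumr_ge0//= -(XYn i) [leRHS](bigID S)/= lerDl.
  by apply: sumr_ge0.
- rewrite exchange_big -sum1_card natr_sum; apply: eq_bigr => j _.
  transitivity ((j == j)%:R : R); last by rewrite eqxx.
  by rewrite -frame_colsum; apply: eq_bigr => i _; rewrite !expr2.
- have aZ (Z : 'M[R]_n) :
      a * \sum_(j | S j) Z i j ^+ 2 <= \sum_j (Z *m A) i j ^+ 2.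
    have := aS (row i Z); rewrite -row_mul => H.
    rewrite (eq_bigr (fun j => row i Z 0 j ^+ 2)) => [|j _]; last by rewrite mxE.
    rewrite [leRHS](eq_bigr (fun j => row i (Z *m A) 0 j ^+ 2)) => [//|j _].
    by rewrite [in RHS]mxE.
  by rewrite sqr_spectrum_row !big_split mulrDr lerD.
Qed.

End SpectralFrame.

(** * The upper bound *)

(** Young's inequality for the conjugate exponents [q^-1] and [(1 - q)^-1]. *)
Lemma weighted_am_gm (R : realType) (t a q : R) : 0 <= t -> 0 <= a -> 0 < q < 1 ->
  t `^ q * a `^ (1 - q) <= q * t + (1 - q) * a.
Proof.
move=> t0 a0 /andP[q0 q1].
have q'0 : 0 < 1 - q by rewrite subr_gt0.
have := @conjugate_powR R (t `^ q) (a `^ (1 - q)) q^-1 (1 - q)^-1.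
rewrite !powR_ge0 !invr_gt0 !invrK -!powRrM !mulfV ?gt_eqF// !powRr1//.
move=> /(_ isT isT q0 q'0); rewrite (mulrC t) (mulrC a); apply; ring.
Qed.

(** The concave q-th power lies below its tangent at [a], by [weighted_am_gm]. The constant term of
    the tangent is nonnegative, so [#|P|] may be raised to [n] in the sum. *)
Lemma sum_powR_le (R : realType) (I : finType) (P : pred I) (t : I -> R)
    (n : nat) (a q : R) :
  0 < q < 1 -> 0 < a -> (#|P| <= n)%N -> (forall i, P i -> 0 <= t i) ->
  \sum_(i | P i) t i <= n%:R * a ->
  \sum_(i | P i) t i `^ q <= n%:R * a `^ q.
Proof.
move=> q01 a0 Pn t0 tn; have /andP[q0 q1] := q01.
have aq : 0 < a `^ (1 - q) by rewrite powR_gt0.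
have aqE : a `^ q * a `^ (1 - q) = a.
  by rewrite -powRD ?(gt_eqF a0) ?implybT// addrC subrK powRr1// ltW.
rewrite -(ler_pM2r aq) -mulrA aqE.
rewrite mulr_suml.
apply: le_trans (_ : \sum_(i | P i) (q * t i + (1 - q) * a) <= _).
  by apply: ler_sum => i Pi; apply: weighted_am_gm => //; [exact: t0|exact: ltW].
rewrite big_split /= -mulr_sumr sumr_const -mulr_natr.
have : (#|P|%:R : R) <= n%:R by rewrite ler_nat.
move: (\sum_(i | P i) t i) tn => T tn Pn'.
have : (1 - q) * a * #|P|%:R <= (1 - q) * a * n%:R.
  by rewrite ler_wpM2l// mulr_ge0// ?subr_ge0 ltW.
have : q * T <= q * (n%:R * a) by rewrite ler_wpM2l// ltW.
by set u := #|P|%:R; set v := n%:R; lra.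
Qed.

Lemma adjmx_tr (R : realType) (G : sgraph) : (adjmx R G)^T = adjmx R G.
Proof. by apply/matrixP => i j; rewrite !mxE edge_sym. Qed.

Lemma normr_powR (R : realType) (x p : R) : `|x| `^ p = (x ^+ 2) `^ (p / 2).
Proof.
by rewrite -real_normK ?num_real// -powR_mulrn// -powRrM mulrCA divff// mulr1.
Qed.

Lemma schatten_norm_upper_bound (R : realType) (p : R) (G : sgraph) (n := gorder G) :
  1 <= p -> p < 2 ->
  schatten_norm p G `^ p <= 2 `^ (- p) * n%:R `^ (1 + p / 2) + n%:R `^ p.
Proof.
move=> p1 p2.
have p0 : 0 < p by lra.
set A := adjmx R G.
have [lam [X [Y [Alam [XA YA] XY1 XYn]]]] := symmetric_spectral_frame (adjmx_tr R G).
rewrite (schatten_norm_powR _ Alam)//.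
have := sum_sqr_spectrum XA YA XY1 XYn.
have [w [w0 w_n]] := rayleigh_weights XA YA XY1.
rewrite -/A; set s := \sum_i \sum_j A i j => w_s.
have -> : \sum_i \sum_j A i j ^+ 2 = s.
  apply: eq_bigr => i _; apply: eq_bigr => j _; rewrite mxE.
  by case: edge; rewrite ?expr1n ?expr0n.
move=> lam2.
have [n0|n0] := posnP n.
  rewrite n0 mulr0n big1 => [|i _]; first by rewrite addr_ge0 ?mulr_ge0 ?powR_ge0.
  by have := ltn_ord i; rewrite [X in (_ < X)%N]n0.
have nR : (0 : R) < n%:R by rewrite ltr0n.
have s_ge0 : 0 <= s.
  by apply: sumr_ge0 => i _; apply: sumr_ge0 => j _; rewrite mxE ler0n.
have s_le : s <= n%:R ^+ 2.
  rewrite (_ : n%:R ^+ 2 = \sum_(i < gorder G) \sum_(j < gorder G) 1).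
    by apply: ler_sum => i _; apply: ler_sum => j _; rewrite mxE lern1 leq_b1.
  by rewrite !sumr_const card_ord -mulrnA mulnn natrX.
(* If every modulus were below [s / n], so would be their mean with weights [w], which is at least
   the Rayleigh quotient [s / n]. *)
have [i0 i0s] : exists i0, s <= `|lam 0 i0| * n%:R.
  apply/not_existsP => H.
  have {}H i : `|lam 0 i| * n%:R < s by rewrite ltNge; apply/negP/H.
  have : \sum_i `|lam 0 i| * n%:R * w i < \sum_i s * w i.
    have [i wi] : exists i, 0 < w i.
      apply/not_existsP => W; have : \sum_i w i <= 0.
        by apply: sumr_le0 => i _; rewrite leNgt; apply/negP/W.
      by rewrite w_n leNgt nR.
    rewrite (bigD1 i)//= [ltRHS](bigD1 i)//= ltr_leD// ?ltr_pM2r//.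
    by apply: ler_sum => j _; rewrite ler_wpM2r// ltW.
  rewrite -mulr_sumr w_n ltNge => /negP; apply.
  rewrite -w_s mulr_suml; apply: ler_sum => i _.
  by rewrite mulrAC ler_wpM2r ?ler0n// ler_wpM2r// ler_norm.
have lam_i0 : lam 0 i0 ^+ 2 <= s.
  by rewrite -lam2 (bigD1 i0)//= lerDl sumr_ge0// => i _; exact: sqr_ge0.
rewrite (bigD1 i0)//= addrC; apply: lerD; last first.
  rewrite ge0_ler_powR ?nnegrE ?normr_ge0 ?(ltW p0) ?(ltW nR)//.
  rewrite -(@ler_pXn2r _ 2)// ?nnegrE ?normr_ge0 ?(ltW nR)// real_normK ?num_real//.
  exact: le_trans s_le.
under eq_bigr do rewrite normr_powR.
apply: le_trans (_ : n%:R * (n%:R / 4) `^ (p / 2) <= _).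
  apply: sum_powR_le.
  - lra.
  - by rewrite divr_gt0.
  - by rewrite (leq_trans (max_card _))// card_ord.
  - by move=> i _; exact: sqr_ge0.
  - have -> : \sum_(i < gorder G | i != i0) lam 0 i ^+ 2 = s - lam 0 i0 ^+ 2.
      by rewrite -lam2 [in RHS](bigD1 i0)//= addrAC subrr add0r.
    have ss : s ^+ 2 <= lam 0 i0 ^+ 2 * n%:R ^+ 2.
      rewrite -(real_normK (num_real (lam 0 i0))) -exprMn.
      by rewrite ler_pXn2r ?nnegrE ?mulr_ge0 ?(ltW nR).
    rewrite -(ler_pM2r (exprn_gt0 2 nR)) mulrBl.
    move: ss; set u := lam 0 i0 ^+ 2 * _; set v := n%:R.
    (* This square gives [s - (s / n)^2 <= n^2 / 4], here multiplied by [n^2]; hence the mean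
       [n / 4] above. *)
    have := sqr_ge0 (v ^+ 2 - 2 * s); nra.
rewrite powRD ?(gt_eqF nR) ?implybT// powRr1 ?(ltW nR)// mulrCA ler_wpM2l ?(ltW nR)//.
rewrite powRM ?invr_ge0 ?(ltW nR)// mulrC ler_wpM2r ?powR_ge0//.
rewrite -powR_inv1// -powRrM (_ : 4 = 2 `^ 2%:R).
  by rewrite -powRrM (_ : 2%:R * (-1 * (p / 2)) = - p)//; field.
by rewrite powR_mulrn//; ring.
Qed.

(** * Graphs from regular symmetric Hadamard matrices *)

(* H is the matrix with entries (-1)^(e x y), so that A = (J - H) / 2 is the
   adjacency matrix of e. *)
Definition graphical_hadamard (T : finType) (e : rel T) (r : nat) : Prop :=
  [/\ symmetric e /\ irreflexive e, #|T| = (r ^ 2)%N,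
      forall x, \sum_y (-1) ^+ e x y = r%:Z
    & forall x y, \sum_z (-1) ^+ e x z * (-1) ^+ e z y = r%:Z ^+ 2 * (x == y)%:R].

Definition hadamard_root (r : nat) : Prop :=
  exists (T : finType) (e : rel T), graphical_hadamard e r.

Lemma hadamard_root1 : hadamard_root 1.
Proof.
exists unit, (fun _ _ => false); split=> //.
- by rewrite card_unit.
- by move=> x; rewrite big_const card_unit.
- by move=> [] []; rewrite big_const card_unit.
Qed.

(** In a Kronecker product signs multiply, so their exponents add modulo 2, and the sums factor. *)
Lemma hadamard_rootM r s : hadamard_root r -> hadamard_root s -> hadamard_root (r * s).
Proof.
move=> [T [e [[eC eI] Tr er ee]]] [U [f [[fC fI] Us fs ff]]].
exists (T * U)%type, (fun x y => e x.1 y.1 (+) f x.2 y.2); split.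
- by split=> [x y|x]; rewrite ?eI ?fI// eC fC.
- by rewrite card_prod Tr Us expnMn.
- move=> [x u]; rewrite -(pair_bigA _ (fun y v => (-1) ^+ (e x y (+) f u v)))/=.
  under eq_bigr do under eq_bigr do rewrite signr_addb.
  by rewrite -big_distrlr er fs PoszM.
- move=> [x u] [y v].
  rewrite -(pair_bigA _ (fun z w =>
    (-1) ^+ (e x z (+) f u w) * (-1) ^+ (e z y (+) f w v)))/=.
  under eq_bigr do under eq_bigr do rewrite !signr_addb mulrACA.
  rewrite -big_distrlr /= ee ff PoszM xpair_eqE -mulnb natrM; ring.
Qed.

(** Folds over lists of naturals make the conditions evaluable by [vm_compute]. *)
Lemma hadamard_root_check (r : nat) (k : rel nat)
    (chi := fun i j => (-1) ^+ k i j : int) (s := iota 0 (r ^ 2)) :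
  symmetric k -> irreflexive k ->
  all (fun i => foldr (fun j c => chi i j + c) 0 s == r%:Z) s ->
  all (fun i => all (fun j =>
    foldr (fun z c => chi i z * chi z j + c) 0 s == r%:Z ^+ 2 * (i == j)%:R) s) s ->
  hadamard_root r.
Proof.
move=> kC kI /allP kr /allP kk.
have sP (i : 'I_(r ^ 2)) : (i : nat) \in s by rewrite mem_iota ltn_ord.
have sumE (F : nat -> int) : \sum_(i < r ^ 2) F i = foldr (fun j c => F j + c) 0 s.
  by rewrite -(big_mkord xpredT F) unlock /index_iota subn0.
exists 'I_(r ^ 2), (relpre val k); split.
- by split=> [x y|x]; [exact: kC|exact: kI].
- exact: card_ord.
- by move=> i; rewrite (sumE (chi i)); apply/eqP/kr.
- move=> i j; rewrite (sumE (fun z => chi i z * chi z j)).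
  by have /allP/(_ _ (sP j))/eqP := kk _ (sP i).
Qed.

(** The graph consists of two disjoint edges. *)
Lemma hadamard_root2 : hadamard_root 2.
Proof.
apply: (@hadamard_root_check _ (fun i j => (i != j) && (i %/ 2 == j %/ 2)%N)).
- by move=> i j; rewrite eq_sym [(i %/ 2 == _)%N]eq_sym.
- by move=> i; rewrite eqxx.
- by vm_compute.
- by vm_compute.
Qed.

(* The Latin-square graph of Z/6: cells of its addition table are adjacent
   when they share the row, the column or the entry. It is strongly regular
   with parameters (36, 15, 6, 6). *)
Lemma hadamard_root6 : hadamard_root 6.
Proof.
apply: (@hadamard_root_check _ (fun i j => (i != j) &&
  [|| i %/ 6 == j %/ 6, i == j %[mod 6]
    | i %/ 6 + i %% 6 == j %/ 6 + j %% 6 %[mod 6]])%N).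
- move=> i j; rewrite eq_sym [(i %/ 6 == _)%N]eq_sym.
  by rewrite [(i %% 6 == _)%N]eq_sym [((_ + _) %% _ == _)%N]eq_sym.
- by move=> i; rewrite eqxx.
- by vm_compute.
- by vm_compute.
Qed.

Lemma hadamard_root_smooth a b : hadamard_root (2 ^ a * 6 ^ b).
Proof.
apply: hadamard_rootM.
  elim: a => [|a IH]; first exact: hadamard_root1.
  by rewrite expnS; apply: hadamard_rootM => //; exact: hadamard_root2.
elim: b => [|b IH]; first exact: hadamard_root1.
by rewrite expnS; apply: hadamard_rootM => //; exact: hadamard_root6.
Qed.

(** These are the entries of [A^2] for [A = (J - H) / 2], expanded with [J^2 = r^2 J],
    [HJ = JH = rJ] and [H^2 = r^2 I]. *)
Lemma sum_adj (R : realType) (T : finType) (e : rel T) (r : nat) (x y : T) :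
  graphical_hadamard e r ->
  \sum_z (e x z)%:R * (e z y)%:R =
  (r%:R ^+ 2 - 2 * r%:R) / 4 + r%:R ^+ 2 / 4 * (x == y)%:R :> R.
Proof.
move=> [[eC _] Tr er ee].
have eE u v : (e u v)%:R = (1 - (-1) ^+ e u v) / 2 :> R.
  by case: (e u v); rewrite /= ?expr1 ?expr0; field.
have toR (F : T -> int) (c : int) : \sum_z F z = c -> \sum_z (F z)%:~R = c%:~R :> R.
  by move=> <-; rewrite rmorph_sum.
have h1 u : \sum_z (-1) ^+ e u z = r%:R :> R.
  by rewrite -[RHS](toR _ _ (er u)); apply: eq_bigr => z _; rewrite rmorph_sign.
have h2 : \sum_z (-1) ^+ e x z * (-1) ^+ e z y = r%:R ^+ 2 * (x == y)%:R :> R.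
  transitivity ((r%:Z ^+ 2 * (x == y)%:R)%:~R : R); last first.
    by rewrite rmorphM rmorphXn /= rmorph_nat -pmulrn.
  rewrite -(toR _ _ (ee x y)); apply: eq_bigr => z _.
  by rewrite rmorphM !rmorph_sign.
have h1' : \sum_z (-1) ^+ e z y = r%:R :> R.
  by rewrite -(h1 y); apply: eq_bigr => z _; rewrite eC.
have h0 : \sum_(z : T) 1 = r%:R ^+ 2 :> R by rewrite sumr_const Tr natrX.
transitivity (\sum_z (1 - (-1) ^+ e x z - (-1) ^+ e z y
                       + (-1) ^+ e x z * (-1) ^+ e z y) / 4 : R).
  by apply: eq_bigr => z _; rewrite !eE; field.
by rewrite -mulr_suml !big_split /= !sumrN h0 h1 h1' h2; field.
Qed.

Lemma hadamard_schatten_lower_bound (R : realType) (r n : nat) :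
  hadamard_root r -> (2 <= r)%N -> (r ^ 2 <= n)%N ->
  exists2 G : sgraph, gorder G = n &
    forall p : R, 0 < p -> p <= 2 ->
      r%:R ^+ 2 * (r%:R / 2) `^ p <= schatten_norm p G `^ p.
Proof.
move=> [T [e he]] r2 rn; have [[eC eI] Tr _ _] := he.
pose V : finType := (T + 'I_(n - r ^ 2))%type.
pose f (x y : V) := if (x, y) is (inl a, inl b) then e a b else false.
have fC : symmetric f by move=> [a|i] [b|j] //; exact: eC.
have fI : irreflexive f by move=> [a|i] //; exact: eI.
pose G := SGraph fC fI.
have Gn : gorder G = n by rewrite /gorder card_sum Tr card_ord subnKC.
exists G => // p p0 p2.
have [lam [X [Y [Alam [XA YA] XY1 XYn]]]] := symmetric_spectral_frame (adjmx_tr R G).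
rewrite (schatten_norm_powR _ Alam)//.
pose inT (x : V) := if x is inl _ then true else false.
pose S (i : 'I_(gorder G)) := inT (enum_val i).
have sumV (F : V -> R) : \sum_(i < gorder G) F (enum_val i) = \sum_x F x.
  by rewrite [RHS](reindex _ (onW_bij _ (@enum_val_bij V))).
(* [r^2 / 4] is the coefficient of [I] in [A^2]; the [J] term adds [(r^2 - 2 r) / 4] times a square,
   nonnegative as [2 <= r]. *)
have [|w [w01 wS w_lam]] :=
  @compression_weights _ _ _ _ _ _ XA YA XY1 XYn S (r%:R ^+ 2 / 4).
  move=> u; pose v (x : V) := u 0 (enum_rank x).
  have -> : \sum_(j | S j) u 0 j ^+ 2 = \sum_(a : T) v (inl a) ^+ 2.
    rewrite big_mkcond.
    rewrite (eq_bigr (fun j => if inT (enum_val j) then v (enum_val j) ^+ 2 else 0)).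
      rewrite (sumV (fun x => if inT x then v x ^+ 2 else 0)) big_sumType /=.
      by rewrite [X in _ + X]big1 ?addr0.
    by move=> j _; rewrite /v enum_valK.
  have -> : \sum_j (u *m adjmx R G) 0 j ^+ 2 =
      \sum_(b : T) (\sum_(a : T) v (inl a) * (e a b)%:R) ^+ 2.
    rewrite (eq_bigr (fun j => (\sum_x v x * (f x (enum_val j))%:R) ^+ 2)).
      rewrite (sumV (fun y => (\sum_x v x * (f x y)%:R) ^+ 2)) big_sumType /=.
      rewrite [X in _ + X]big1 ?addr0 => [|i _].
        apply: eq_bigr => b _; rewrite big_sumType /=.
        by rewrite [X in _ + X]big1 ?addr0// => i _; rewrite mulr0.
      by rewrite big1 ?expr0n// => -[a|j] _ /=; rewrite mulr0.
    move=> j _; rewrite -(sumV (fun x => v x * (f x (enum_val j))%:R)) mxE.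
    by congr (_ ^+ 2); apply: eq_bigr => i _; rewrite mxE /v enum_valK.
  have -> : \sum_(b : T) (\sum_(a : T) v (inl a) * (e a b)%:R) ^+ 2 =
      \sum_(a : T) \sum_(a' : T) v (inl a) * v (inl a') *
        ((r%:R ^+ 2 - 2 * r%:R) / 4 + r%:R ^+ 2 / 4 * (a == a')%:R).
    transitivity (\sum_(b : T) \sum_(a : T) \sum_(a' : T)
        v (inl a) * v (inl a') * ((e a b)%:R * (e b a')%:R)).
      apply: eq_bigr => b _; rewrite expr2 big_distrlr.
      by apply: eq_bigr => a _; apply: eq_bigr => a' _; rewrite [e b a']eC mulrACA.
    rewrite exchange_big; apply: eq_bigr => a _.
    rewrite exchange_big; apply: eq_bigr => a' _.
    by rewrite -mulr_sumr (sum_adj _ _ _ he).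
  have -> : \sum_(a : T) \sum_(a' : T) v (inl a) * v (inl a') *
        ((r%:R ^+ 2 - 2 * r%:R) / 4 + r%:R ^+ 2 / 4 * (a == a')%:R) =
      (r%:R ^+ 2 - 2 * r%:R) / 4 * (\sum_(a : T) v (inl a)) ^+ 2
      + r%:R ^+ 2 / 4 * \sum_(a : T) v (inl a) ^+ 2.
    rewrite (expr2 (\sum_(a : T) _)) big_distrlr /= !mulr_sumr -big_split.
    apply: eq_bigr => a _ /=.
    have -> : r%:R ^+ 2 / 4 * v (inl a) ^+ 2 =
        \sum_(a' : T) r%:R ^+ 2 / 4 * (v (inl a) * v (inl a') * (a == a')%:R).
      rewrite -mulr_sumr (bigD1 a)//= eqxx mulr1 -expr2 [X in _ + X]big1 ?addr0// => a'.
      by rewrite eq_sym => /negbTE->; rewrite mulr0.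
    by rewrite mulr_sumr -big_split; apply: eq_bigr => a' _ /=; ring.
  rewrite lerDr mulr_ge0 ?sqr_ge0// divr_ge0// subr_ge0 expr2 ler_wpM2r//.
  by rewrite ler_nat.
have r0 : (0 : R) < r%:R by rewrite ltr0n (ltn_trans _ r2).
have -> : r%:R ^+ 2 * (r%:R / 2) `^ p = \sum_i (r%:R / 2) `^ p * w i :> R.
  rewrite -mulr_sumr wS mulrC; congr (_ * _).
  have -> : #|S|%:R = \sum_(i < gorder G) (if inT (enum_val i) then 1 else 0) :> R.
    by rewrite -sum1_card natr_sum big_mkcond.
  rewrite (sumV (fun x => if inT x then 1 else 0)) big_sumType /=.
  by rewrite [X in _ + X]big1 ?addr0// sumr_const Tr natrX.
apply: ler_sum => i _; have /andP[w0 w1] := w01 i.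
(* Passing from [w i] to its power [p / 2] only increases it, as [w i <= 1] and [p / 2 <= 1]; then
   the bound on [lam 0 i ^+ 2] is raised to the power [p / 2]. *)
apply: le_trans (_ : (r%:R / 2) `^ p * w i `^ (p / 2) <= _).
  rewrite ler_wpM2l ?powR_ge0//.
  have [->|wi0] := eqVneq (w i) 0; first exact: powR_ge0.
  by apply: ger1_powR; [rewrite lt_neqAle eq_sym wi0 w0|lra].
rewrite -(ger0_norm (_ : 0 <= r%:R / 2 :> R)) ?divr_ge0// ?(ltW r0)//.
rewrite !normr_powR -powRM ?sqr_ge0//.
rewrite ge0_ler_powR ?nnegrE ?sqr_ge0 ?(mulr_ge0 (sqr_ge0 _))//; first lra.
by apply: le_trans (w_lam i); rewrite le_eqVlt; apply/orP; left; apply/eqP; field.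
Qed.

(** * Density of the orders *)

Lemma archi_divn (R : realType) (g x : R) : 0 < g -> 0 <= x ->
  exists q : nat, q%:R * g <= x < q%:R * g + g.
Proof.
move=> g0 x0; exists (Num.trunc (x / g)).
have /truncn_itv : 0 <= x / g by rewrite divr_ge0// ltW.
by rewrite ler_pdivlMr// ltr_pdivrMr// -natr1 mulrDl mul1r.
Qed.

Section DenseSemigroup.
Variables (R : realType) (al be : R).
Hypotheses (al0 : 0 < al) (be0 : 0 < be).
Hypothesis incommensurable : forall m k : nat, (0 < k)%N -> m%:R * al != k%:R * be.

Definition intcomb (g : R) := exists x y : int, g = x%:~R * al + y%:~R * be.

Lemma intcombB g h (q : nat) : intcomb g -> intcomb h -> intcomb (g - q%:R * h).
Proof.
move=> [x [y ->]] [x' [y' ->]]; exists (x - q%:Z * x'), (y - q%:Z * y').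
by rewrite !rmorphB !rmorphM /=; ring.
Qed.

(** Divide [al] and [be] by [g]. For a nonzero remainder [r], one of [r] and [g - r] is at most
    [g / 2]; if both remainders vanish, [al] and [be] are commensurable. *)
Lemma intcomb_halve g : intcomb g -> 0 < g -> exists2 h, intcomb h & 0 < h <= g / 2.
Proof.
move=> gC g0.
have half r : intcomb r -> 0 < r < g -> exists2 h, intcomb h & 0 < h <= g / 2.
  move=> rC /andP[r0 rg]; have [rh|rh] := leP r (g / 2).
    by exists r => //; rewrite r0.
  exists (g - 1%:R * r); first exact: intcombB.
  by rewrite mul1r; apply/andP; split; lra.
have alC : intcomb al by exists 1, 0; rewrite mul1r mul0r addr0.
have beC : intcomb be by exists 0, 1; rewrite mul1r mul0r add0r.
have [q /andP[q1 q2]] := archi_divn g0 (ltW al0).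
have [k /andP[k1 k2]] := archi_divn g0 (ltW be0).
have [qE|qN] := eqVneq al (q%:R * g); last first.
  apply: (half (al - q%:R * g)); first exact: intcombB.
  by rewrite subr_gt0 lt_neqAle eq_sym qN q1 /=; lra.
have [kE|kN] := eqVneq be (k%:R * g); last first.
  apply: (half (be - k%:R * g)); first exact: intcombB.
  by rewrite subr_gt0 lt_neqAle eq_sym kN k1 /=; lra.
have q0 : (0 < q)%N by case: q qE {q1 q2} => // qE; move: al0; rewrite qE mul0r ltxx.
have := incommensurable k q0; rewrite {1}qE {1}kE.
by rewrite mulrCA eqxx.
Qed.

(** Repeated halving starts from [al] and stops at a [k] with [al / eps < k < 2 ^ k]. *)
Lemma intcomb_small eps : 0 < eps -> exists2 g, intcomb g & 0 < g < eps.
Proof.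
move=> eps0.
have H k : exists2 g, intcomb g & 0 < g <= al / 2 ^+ k.
  elim: k => [|k [g gC /andP[g0 gk]]].
    by exists al; [exists 1, 0; rewrite mul1r mul0r addr0|rewrite expr0 divr1 al0 lexx].
  have [h hC /andP[h0 hg]] := intcomb_halve gC g0; exists h => //; rewrite h0 /=.
  by rewrite exprS invfM mulrCA mulrC (le_trans hg)// ler_wpM2r.
pose k := (Num.trunc (al / eps)).+1.
have kgt : al / eps < k%:R by exact: truncnS_gt.
have [g gC /andP[g0 gk]] := H k; exists g => //; rewrite g0 (le_lt_trans gk)//.
rewrite ltr_pdivrMr ?exprn_gt0// mulrC -ltr_pdivrMr// (lt_trans kgt)//.
by rewrite -natrX ltr_nat ltn_expl.
Qed.
End DenseSemigroup.

(** Take [K * y] copies of [be] and add copies of [al] until the gap to [X] is below [al].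
    Exchanging [y] copies of [be] for [x] copies of [al] gains [g]; as [al < K * g], at most [K]
    exchanges bring the gap below [g]. *)
Lemma semigroup_step (R : realType) (al be g : R) (x y : nat) :
  0 < al -> 0 < g -> g = x%:R * al - y%:R * be ->
  exists X0 : R, forall X, X0 <= X ->
    exists a b : nat, X - g < a%:R * al + b%:R * be <= X.
Proof.
move=> al0 g0 gE; pose K := (Num.trunc (al / g)).+1.
have Kg : al < K%:R * g by rewrite -ltr_pdivrMr//; exact: truncnS_gt.
exists (K%:R * y%:R * be) => X; rewrite -subr_ge0 => X0.
have [s /andP[s1 s2]] := archi_divn al0 X0.
have l0 : 0 <= X - K%:R * y%:R * be - s%:R * al by rewrite subr_ge0.
have [k /andP[k1 k2]] := archi_divn g0 l0.
have kK : (k <= K)%N.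
  rewrite -(ler_nat R) -(ler_pM2r g0) (le_trans k1)//; lra.
exists (s + k * x)%N, ((K - k) * y)%N.
rewrite natrD !natrM natrB//.
have -> : (s%:R + k%:R * x%:R) * al + (K%:R - k%:R) * y%:R * be =
  K%:R * y%:R * be + s%:R * al + k%:R * g by rewrite gE; ring.
by apply/andP; split; lra.
Qed.

Lemma semigroup_dense (R : realType) (al be eps : R) :
  0 < al -> 0 < be -> (forall m k : nat, (0 < k)%N -> m%:R * al != k%:R * be) ->
  0 < eps ->
  exists X0 : R, forall X, X0 <= X ->
    exists a b : nat, X - eps < a%:R * al + b%:R * be <= X.
Proof.
move=> al0 be0 inc eps0.
pose d := Num.min eps (Num.min al be).
have d0 : 0 < d by rewrite !lt_min eps0 al0.
have [g [x [y gE]] /andP[g0]] := intcomb_small al0 be0 inc d0.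
rewrite !lt_min => /and3P[geps gal gbe].
have weaken :
    (exists X0 : R, forall X, X0 <= X ->
      exists a b : nat, X - g < a%:R * al + b%:R * be <= X) ->
    exists X0 : R, forall X, X0 <= X ->
      exists a b : nat, X - eps < a%:R * al + b%:R * be <= X.
  move=> [X0 HX]; exists X0 => X /HX[a [b /andP[h1 h2]]]; exists a, b.
  by rewrite h2 andbT; lra.
(* As [0 < g] and [g] is below both generators, one coefficient is negative and the other is not;
   either mixed case is an exchange for [semigroup_step]. [Negz y] means [-(y + 1)]. *)
case: x y gE => x [] y gE.
- exfalso; case: x gE => [|x] gE.
    case: y gE => [|y] gE; first by move: g0; rewrite gE; lra.
    have : be <= y.+1%:R * be by rewrite ler_peMl ?ler1n// ltW.
    by move: gbe; rewrite gE; lra.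
  have : al <= x.+1%:R * al by rewrite ler_peMl ?ler1n// ltW.
  have : 0 <= y%:R * be by rewrite mulr_ge0// ltW.
  by move: gal; rewrite gE; lra.
- apply: weaken; apply: (@semigroup_step _ _ _ _ x y.+1) => //.
  by rewrite gE NegzE mulrNz; ring.
- apply: weaken; have [|X0 HX] := @semigroup_step _ be al g y x.+1 be0 g0.
    by rewrite gE NegzE mulrNz; ring.
  by exists X0 => X /HX[b [a ab]]; exists a, b; rewrite [_ * al + _]addrC.
- exfalso; have : 0 <= x.+1%:R * al by rewrite mulr_ge0// ltW.
  have : 0 <= y.+1%:R * be by rewrite mulr_ge0// ltW.
  by move: g0; rewrite gE !NegzE !mulrNz; lra.
Qed.

(** Otherwise [2 ^ m = 6 ^ k], where 3 divides only the right side. *)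
Lemma ln2_ln6_incommensurable (R : realType) (m k : nat) : (0 < k)%N ->
  m%:R * ln (2 : R) != k%:R * ln 6.
Proof.
move=> k0; apply/eqP; rewrite !mulr_natl -!lnXn//.
move/ln_inj; rewrite !posrE !exprn_gt0// => /(_ isT isT)/eqP.
rewrite -!natrX eqr_nat => /eqP E.
have : (3 %| 6 ^ k)%N by rewrite (@dvdn_trans (6 ^ 1))// dvdn_exp2l.
by rewrite -E Euclid_dvdX//.
Qed.

Lemma ln_smooth (R : realType) (a b : nat) :
  ln (((2 ^ a * 6 ^ b)%N)%:R : R) = a%:R * ln 2 + b%:R * ln 6.
Proof.
by rewrite natrM !natrX lnM ?posrE ?exprn_gt0// !lnXn// !mulr_natl.
Qed.

Lemma hadamard_root_dense (R : realType) (eps : R) : 0 < eps ->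
  exists N : nat, forall n, (N <= n)%N ->
    exists r : nat, [/\ hadamard_root r, (2 <= r)%N, (r ^ 2 <= n)%N
                      & ln n%:R / 2 - eps <= ln (r%:R : R)].
Proof.
move=> eps0; pose d := Num.min eps (ln 2).
have ln2 : 0 < ln 2 :> R by rewrite ln_gt0// ltr1n.
have ln6 : 0 < ln 6 :> R by rewrite ln_gt0// ltr1n.
have d0 : 0 < d by rewrite lt_min eps0.
have [X0 HX] := semigroup_dense ln2 ln6 (@ln2_ln6_incommensurable R) d0.
(* The window below [ln n / 2] has length at most [ln 2], so [ln n / 2 >= ln 2 + ln 2] forces
   [2 <= r]. *)
exists (Num.trunc (expR (2 * Num.max X0 (ln 2 + ln 2)))).+1 => n Nn.
have n0 : (0 : R) < n%:R by rewrite ltr0n (leq_trans _ Nn).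
have Xn : Num.max X0 (ln 2 + ln 2) <= ln n%:R / 2.
  rewrite ler_pdivlMr// mulrC -[leLHS]expRK ler_ln ?posrE ?expR_gt0//.
  by rewrite ltW// (lt_le_trans (truncnS_gt _))// ler_nat.
move: Xn; rewrite ge_max => /andP[Xn1 Xn2].
have [a [b /andP[h1 h2]]] := HX _ Xn1.
have dm : d <= ln 2 by rewrite ge_min lexx orbT.
have de : d <= eps by rewrite ge_min lexx.
have r0 : (0 : R) < (2 ^ a * 6 ^ b)%N%:R by rewrite ltr0n muln_gt0 !expn_gt0.
exists (2 ^ a * 6 ^ b)%N; split.
- exact: hadamard_root_smooth.
- by rewrite -(ler_nat R) -ler_ln ?posrE// ln_smooth; lra.
- rewrite -(ler_nat R) natrX -ler_ln ?posrE ?exprn_gt0// lnXn// ln_smooth.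
  by rewrite -mulr_natl; lra.
- by rewrite ln_smooth; lra.
Qed.

(** * The extremal family and its asymptotics *)

(** The graph must be fixed before the accuracy is. The largest admissible [r] serves all smaller
    ones, as the bound increases with [r]; if none is admissible, an edgeless graph is taken. *)
Lemma extremal_graph (R : realType) (n : nat) :
  exists G : sgraph, gorder G = n /\
    forall r, hadamard_root r -> (2 <= r)%N -> (r ^ 2 <= n)%N ->
    forall p : R, 0 < p -> p <= 2 ->
      r%:R ^+ 2 * (r%:R / 2) `^ p <= schatten_norm p G `^ p.
Proof.
pose P r := `[< [/\ hadamard_root r, (2 <= r)%N & (r ^ 2 <= n)%N] >].
have [exP|noP] := pselect (exists r, P r); last first.
  have sF : symmetric (fun _ _ : 'I_n => false) by [].
  have iF : irreflexive (fun _ _ : 'I_n => false) by [].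
  exists (SGraph sF iF); split; first exact: card_ord.
  by move=> r hr r2 rn; case: noP; exists r; apply/asboolP.
have bP r : P r -> (r <= n)%N.
  move/asboolP => [_ _]; apply: leq_trans; rewrite -mulnn.
  by case: r => // r; rewrite leq_pmulr.
case: (ex_maxnP exP bP) => s /asboolP[hs s2 sn] smax.
have [G Gn Gp] := hadamard_schatten_lower_bound R hs s2 sn.
exists G; split=> // r hr r2 rn p p0 p2; apply: le_trans (Gp p p0 p2).
have rs : (r%:R : R) <= s%:R by rewrite ler_nat smax//; apply/asboolP.
apply: ler_pM; rewrite ?powR_ge0 ?sqr_ge0//; first by rewrite ler_pXn2r ?nnegrE.
rewrite ge0_ler_powR ?nnegrE ?divr_ge0// ?(ltW p0)//.
by rewrite ler_pM2r.
Qed.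

Theorem theorem9 (R : realType) (p : R) (hp1 : 1 <= p) (hp2 : p < 2) :
  (forall (n : nat) (G : sgraph), gorder G = n ->
     schatten_norm p G `^ p <= 2 `^ (- p) * n%:R `^ (1 + p / 2) + n%:R `^ p)
  /\
  (exists (G : nat -> sgraph) (eps : nat -> R),
     [/\ forall n : nat, gorder (G n) = n,
         eps n @[n --> \oo] --> (0 : R) &
         forall n : nat,
           schatten_norm p (G n) `^ p
           = (2 `^ (- p) + eps n) * n%:R `^ (1 + p / 2)]).
Proof.
have ub n (G : sgraph) : gorder G = n ->
    schatten_norm p G `^ p <= 2 `^ (- p) * n%:R `^ (1 + p / 2) + n%:R `^ p.
  by move=> <-; exact: schatten_norm_upper_bound.
split=> //.
have p0 : 0 < p by lra.
have [G Gspec] := choice (extremal_graph R).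
have Gn n : gorder (G n) = n by case: (Gspec n).
pose q := 1 + p / 2.
have q0 : 0 < q by rewrite addr_gt0// divr_gt0.
pose eps n := schatten_norm p (G n) `^ p / n%:R `^ q - 2 `^ (- p).
exists G, eps; split=> // [|n]; last first.
  rewrite /eps [2 `^ _ + _]addrC subrK -/q.
  have [->|n0] := posnP n; last by rewrite divfK// lt0r_neq0// powR_gt0 ?ltr0n.
  (* At [n = 0] the right side is 0, and the upper bound forces the left side to be 0. *)
  rewrite mulr0n [0 `^ q]powR0 ?gt_eqF// mulr0.
  apply/eqP; rewrite eq_le powR_ge0 andbT (le_trans (ub _ _ (Gn 0%N)))//.
  by rewrite mulr0n !powR0 ?gt_eqF// mulr0 addr0.
apply/cvgrPdist_le => e e0.
have [N HN] : exists N : nat, forall n, (N <= n)%N -> `|eps n| <= e; last first.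
  by exists N => // n /= Nn; rewrite sub0r normrN; exact: HN.
have e4 : 0 < e / 4 by rewrite divr_gt0.
(* A loss of [e / 4] in [ln r] costs [(2 + p) / 4 * e <= e] in the exponent. *)
have [N HN] := hadamard_root_dense e4.
(* As [c = q - p], the ratio of the p-th and q-th powers of [n] is [n^(-c)], at most [e] once
   [n >= e^(-1/c)]. *)
pose c := 1 - p / 2; have c0 : 0 < c by rewrite /c; lra.
exists (maxn N (Num.trunc (e^-1 `^ c^-1)).+1) => n; rewrite geq_max => /andP[Nn Mn].
have n0 : (0 : R) < n%:R by rewrite ltr0n (leq_trans _ Mn).
have nq0 : 0 < n%:R `^ q :> R by rewrite powR_gt0.
rewrite ler_norml; apply/andP; split.
  rewrite /eps lerBrDl ler_pdivlMr//.
  have [r [hr r2 rn rln]] := HN _ Nn.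
  have [_ /(_ _ hr r2 rn _ p0 (ltW hp2)) Gp] := Gspec n.
  apply: le_trans Gp.
  have r0 : (0 : R) < r%:R by rewrite ltr0n (leq_trans _ r2).
  have -> : r%:R ^+ 2 * (r%:R / 2) `^ p = 2 `^ (- p) * expR ((2 + p) * ln r%:R) :> R.
    rewrite powRM ?invr_ge0 ?(ltW r0)// -powR_inv1// -powRrM mulN1r mulrA.
    rewrite -(powR_mulrn 2 (ltW r0)) -powRD ?(gt_eqF r0) ?implybT// mulrC.
    by congr (_ * _); rewrite /powR (gt_eqF r0).
  have -> : n%:R `^ q = expR (q * ln n%:R) by rewrite /powR gt_eqF.
  have E : (2 + p) * ln r%:R >= q * ln n%:R - e.
    have H : (2 + p) * (ln n%:R / 2 - e / 4) <= (2 + p) * ln r%:R.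
      by rewrite ler_pM2l//; lra.
    apply: le_trans H.
    have -> : (2 + p) * (ln n%:R / 2 - e / 4) = q * ln n%:R - (2 + p) / 4 * e.
      by rewrite /q; field.
    rewrite lerD2l lerN2 ger_pMl//; lra.
  have p21 : 2 `^ (- p) <= 1 :> R.
    by rewrite -[leRHS](powRr0 2) ler_powR ?ler1n//; lra.
  (* [p21] makes the absolute error [e] a relative one, and [1 - e <= expR (- e)] moves it into the
     exponent. *)
  apply: le_trans (_ : 2 `^ (- p) * ((1 - e) * expR (q * ln n%:R)) <= _).
    rewrite mulrA ler_pM2r ?expR_gt0//.
    by have : 2 `^ (- p) * e <= 1 * e by [rewrite ler_pM2r]; lra.
  rewrite ler_wpM2l ?powR_ge0//.
  apply: le_trans (_ : expR (- e) * expR (q * ln n%:R) <= _).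
    by rewrite ler_pM2r ?expR_gt0// expR_ge1Dx.
  by rewrite -expRD ler_expR addrC.
rewrite /eps lerBlDl ler_pdivrMr// (le_trans (ub _ _ (Gn n)))// mulrDl lerD2l.
have -> : n%:R `^ q = n%:R `^ p * n%:R `^ c.
  by rewrite -powRD ?(gt_eqF n0) ?implybT//; congr (_ `^ _); rewrite /q /c; field.
rewrite mulrCA ler_peMr ?powR_ge0// -ler_pdivrMl// mulr1.
have -> : e^-1 = (e^-1 `^ c^-1) `^ c.
  by rewrite -powRrM mulVf ?gt_eqF// powRr1// invr_ge0 ltW.
rewrite ge0_ler_powR ?nnegrE ?powR_ge0 ?(ltW c0) ?(ltW n0)//.
by rewrite ltW// (lt_le_trans (truncnS_gt _))// ler_nat.
Qed.
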